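(* Let $K$ be a division ring, $S$ an automorphism of $K$ and $D$ an $S$-derivation of $K$, and let $R=K[t;S,D]$. Let $A\in M_n(K)$ be a square matrix. Then $A$ is $(S,D)$-triangularizable if and only if the last invariant factor $e_r\in R$ of $A$ (taken monic) is a product of monic linear polynomials of $R$.
   Context: An $S$-derivation is an additive map $D:K\to K$ with $D(ab)=S(a)D(b)+D(a)b$. $R=K[t;S,D]$ is the Ore ring of skew polynomials $\sum a_it^i$ ($a_i\in K$) with $ta=S(a)t+D(a)$. $S$ and $D$ are extended entrywise to matrices. Two matrices $A,B\in M_n(K)$ are $(S,D)$-similar if $B=S(P)AP^{-1}+D(P)P^{-1}$ for some $P\in GL_n(K)$; $A$ is $(S,D)$-triangularizable if it is $(S,D)$-similar to a triangular matrix. Invariant factors: since $S$ is an automorphism, $R$ is a left and right principal ideal domain. For $f,g\in R$, $f$ strongly divides $g$ (written $f\,||\,g$) if there is $c\in R$ with $cR=Rc$ such that $f$ left divides $c$ (i.e. $c\in fR$) and $c$ left divides $g$ (i.e. $g\in cR$). There are $P,Q\in GL_n(R)$ with $P(tI-A)Q$ diagonal, with each diagonal entry strongly dividing the next. The diagonal entries that are not units, listed in order and reindexed as $e_1,\dots,e_r$ (so $e_1\,||\,e_2\,||\cdots||\,e_r$), are the invariant factors of $A$ (they are determined up to similarity, $f\sim g$ meaning $R/Rf\cong R/Rg$ as left $R$-modules), and $e_r$ is the last one. *)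

(* Defs.v *)
From HB Require Import structures.
From mathcomp Require Import all_boot all_algebra.
From mathcomp Require Import boolp.

Set Implicit Arguments.
Unset Strict Implicit.
Unset Printing Implicit Defensive.

Import GRing.Theory.
Local Open Scope ring_scope.

Record sderivation (K : nzRingType) (S : {rmorphism K -> K}) := SDerivation {
  sder :> {additive K -> K};
  sderM : forall a b : K, sder (a * b) = S a * sder b + sder a * b
}.

(* K[t; S, D]. The coefficients are written on the left of the powers of t, so
   the additive group is that of {poly K}; the product is not. *)
Definition ore (K : nzRingType) (S : {rmorphism K -> K})
  (D : sderivation S) : Type := {poly K}.

HB.instance Definition _ (K : nzRingType) (S : {rmorphism K -> K})
  (D : sderivation S) := GRing.Zmodule.copy (ore D) {poly K}.

Section OreRing.
Variables (K : nzRingType) (S : {rmorphism K -> K}) (D : sderivation S).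
Implicit Types (p q r : {poly K}) (a b : K).

(* Left multiplication by t: t (b t^j) = S(b) t^(j+1) + D(b) t^j. *)
Definition tmul p : {poly K} := map_poly S p * 'X + map_poly D p.

Definition ore_mul p q : {poly K} := \sum_(i < size p) p`_i *: iter i tmul q.

Definition ore_const a : ore D := a%:P.
Definition ore_t : ore D := 'X.

Lemma tmulD : {morph tmul : p q / p + q}.
Proof. by move=> p q; rewrite /tmul !raddfD mulrDl addrACA. Qed.

Lemma tmul0 : tmul 0 = 0.
Proof. by rewrite /tmul !raddf0 mul0r addr0. Qed.

Lemma tmulZ a p : tmul (a *: p) = S a *: tmul p + D a *: p.
Proof.
rewrite /tmul map_polyZ /= scalerDr -scalerAl -addrA; congr (_ + _).
by apply/polyP=> i; rewrite !(coef_map, coefD, coefZ) /= sderM.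
Qed.

Lemma tmulXn i : tmul 'X^i = 'X^(i.+1).
Proof.
have D1 : D 1 = 0.
  by apply: (addrI (D 1)); rewrite -{3}[1 : K]mulr1 sderM rmorph1 mul1r mulr1 addr0.
rewrite /tmul map_polyXn exprSr -[RHS]addr0; congr (_ + _).
by apply/polyP=> j; rewrite coef_map coefXn coef0; case: eqP; rewrite ?raddf0.
Qed.

Lemma iter_tmulD i : {morph iter i tmul : p q / p + q}.
Proof. by elim: i => // i IH p q; rewrite !iterS IH tmulD. Qed.

Lemma iter_tmul0 i : iter i tmul 0 = 0.
Proof. by elim: i => // i IH; rewrite iterS IH tmul0. Qed.

Lemma ore_mulE n p q : (size p <= n)%N ->
  ore_mul p q = \sum_(i < n) p`_i *: iter i tmul q.
Proof.
move=> le_pn; rewrite /ore_mul (big_ord_widen n (fun i => p`_i *: iter i tmul q)) //.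
rewrite big_mkcond; apply: eq_bigr => i _; case: ltnP => // le_pi.
by rewrite nth_default // scale0r.
Qed.

Lemma ore_mulDl : left_distributive ore_mul +%R.
Proof.
move=> p q r; have le_m := size_polyD p q.
rewrite !(@ore_mulE (maxn (size p) (size q))) ?leq_maxl ?leq_maxr //.
by rewrite -big_split; apply: eq_bigr => i _; rewrite coefD scalerDl.
Qed.

Lemma ore_mulDr : right_distributive ore_mul +%R.
Proof.
move=> p q r; rewrite /ore_mul -big_split; apply: eq_bigr => i _.
by rewrite iter_tmulD scalerDr.
Qed.

Lemma ore_mul0l p : ore_mul 0 p = 0.
Proof. by rewrite /ore_mul size_poly0 big_ord0. Qed.

Lemma ore_mul0r p : ore_mul p 0 = 0.
Proof.
by rewrite /ore_mul big1 // => i _; rewrite iter_tmul0 scaler0.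
Qed.

Lemma ore_mulZl a p q : ore_mul (a *: p) q = a *: ore_mul p q.
Proof.
rewrite (ore_mulE _ (size_scale_leq a p)) scaler_sumr.
by apply: eq_bigr => i _; rewrite coefZ scalerA.
Qed.

Lemma ore_mulXn i q : ore_mul 'X^i q = iter i tmul q.
Proof.
rewrite /ore_mul size_polyXn big_ord_recr /= big1 ?add0r.
  by rewrite coefXn eqxx scale1r.
by move=> j _; rewrite coefXn (ltn_eqF (ltn_ord j)) scale0r.
Qed.

Lemma ore_mul_suml n (F : 'I_n -> {poly K}) q :
  ore_mul (\sum_(i < n) F i) q = \sum_(i < n) ore_mul (F i) q.
Proof.
by apply: (big_morph (ore_mul^~ q) (fun x y => ore_mulDl x y q) (ore_mul0l q)).
Qed.

Lemma tmul_sum n (F : 'I_n -> {poly K}) :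
  tmul (\sum_(i < n) F i) = \sum_(i < n) tmul (F i).
Proof. exact: (big_morph tmul tmulD tmul0). Qed.

Lemma tmul_mul p q : ore_mul (tmul p) q = tmul (ore_mul p q).
Proof.
rewrite -[p]coefK poly_def tmul_sum !ore_mul_suml tmul_sum.
apply: eq_bigr => i _; rewrite ore_mulZl !tmulZ ore_mulDl !ore_mulZl.
by rewrite tmulXn !ore_mulXn.
Qed.

Lemma ore_mulA : associative ore_mul.
Proof.
move=> p q r; rewrite [ore_mul p q]/ore_mul ore_mul_suml {1}/ore_mul.
apply: eq_bigr => i _; rewrite ore_mulZl; congr (_ *: _).
by elim: (i : nat) => //= j ->; rewrite tmul_mul.
Qed.

Lemma ore_mul1l : left_id 1 ore_mul.
Proof. by move=> p; rewrite -(expr0 'X) ore_mulXn. Qed.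

Lemma iter_tmul1 i : iter i tmul 1 = 'X^i.
Proof. by elim: i => //= i ->; rewrite tmulXn. Qed.

Lemma ore_mul1r : right_id 1 ore_mul.
Proof.
move=> p; rewrite /ore_mul -[RHS]coefK poly_def.
by apply: eq_bigr => i _; rewrite iter_tmul1.
Qed.

Fact ore_1_neq0 : (1 : {poly K}) != 0. Proof. exact: oner_neq0. Qed.

HB.instance Definition _ := GRing.Zmodule_isNzRing.Build (ore D)
  ore_mulA ore_mul1l ore_mul1r ore_mulDl ore_mulDr ore_1_neq0.

Lemma ore_constE a (f : ore D) : ore_const a * f = a *: (f : {poly K}) :> {poly K}.
Proof.
by rewrite -[LHS]/(ore_mul _ _) /ore_const -[a%:P]mulr1 mul_polyC ore_mulZl ore_mul1l.
Qed.

Lemma ore_commutation a :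
  ore_t * ore_const a = ore_const (S a) * ore_t + ore_const (D a).
Proof.
rewrite ore_constE -[LHS]/(ore_mul 'X a%:P) -['X]expr1 ore_mulXn /= /tmul.
by rewrite !map_polyC mul_polyC.
Qed.

Lemma ore_expansion (f : ore D) :
  f = \sum_(i < size (f : {poly K})) ore_const (f : {poly K})`_i * ore_t ^+ i.
Proof.
have tX i : ore_t ^+ i = 'X^i :> {poly K}.
  elim: i => // i IH; rewrite exprS -[LHS]/(ore_mul 'X _) -['X]expr1 ore_mulXn.
  by rewrite -[iter _ _ _]/(tmul _) IH tmulXn.
rewrite -[LHS](coefK (f : {poly K})) poly_def; apply: eq_bigr => i _.
by rewrite ore_constE tX.
Qed.

End OreRing.

Definition two_sided_inverse (R : pzRingType) (x y : R) : Prop :=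
  x * y = 1 /\ y * x = 1.

(* Units of a ring, and GL_n when the ring is a matrix ring ('M_n is a
   pzRingType for every n, whereas unitmx requires commutative entries). *)
Definition invertible (R : pzRingType) (x : R) : Prop :=
  exists y, two_sided_inverse x y.

Definition strongly_divides (R : pzRingType) (f g : R) : Prop :=
  exists c : R,
    [/\ forall x, (exists y, x = c * y) <-> (exists y, x = y * c),
        exists y, c = f * y
      & exists y, g = c * y].

Section Matrices.
Variables (K : nzRingType) (S : {rmorphism K -> K}) (D : sderivation S).
Variable (n : nat).
Implicit Types (A B : 'M[K]_n).

Definition SD_similar A B : Prop :=
  exists P P' : 'M[K]_n, two_sided_inverse P P' /\
    B = map_mx S P *m A *m P' + map_mx D P *m P'.

(* is_trig_mx is lower triangularity. *)
Definition triangular A : bool := is_trig_mx A || is_trig_mx A^T.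

Definition SD_triangularizable A : Prop :=
  exists B, SD_similar A B /\ triangular B.

Definition ore_char_mx A : 'M[ore D]_n :=
  (ore_t D)%:M - map_mx (ore_const D) A.

(* [:: e_1; ...; e_r] is a sequence of invariant factors of A; it is unique
   only up to similarity of its entries. *)
Definition invariant_factors A (e : seq (ore D)) : Prop :=
  exists (P Q : 'M[ore D]_n) (d : 'rV[ore D]_n),
    [/\ invertible P, invertible Q,
        P *m ore_char_mx A *m Q = diag_mx d,
        forall i j : 'I_n, j = i.+1 :> nat -> strongly_divides (d 0 i) (d 0 j)
      & e = [seq d 0 i | i <- enum 'I_n & ~~ `[< invertible (d 0 i) >]]].

Definition last_invariant_factor A (er : ore D) : Prop :=
  exists s : seq (ore D), invariant_factors A (rcons s er).

Definition product_of_monic_linear (f : ore D) : Prop :=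
  exists s : seq K, f = \prod_(a <- s) (ore_t D - ore_const D a).

End Matrices.

(* The monic left associate of f, for f <> 0 and K a division ring. *)
Definition ore_monic (K : unitRingType) (S : {rmorphism K -> K})
  (D : sderivation S) (f : ore D) : ore D :=
  ore_const D (lead_coef (f : {poly K}))^-1 * f.

(* Main.v *)
From HB Require Import structures.
Require Import Defs.
From mathcomp Require Import all_boot all_algebra.
From mathcomp Require Import boolp.

Set Implicit Arguments.
Unset Strict Implicit.
Unset Printing Implicit Defensive.

Import GRing.Theory.
Local Open Scope ring_scope.

(** Let R = K[t;S,D]. The matrix A makes K^n a left R-module, with t acting on
    row vectors by v |-> S(v) A + D(v); as an R-module it is the quotient of
    R^n by the submodule R^n (tI - A). The matrices (S,D)-similar to A are the
    matrices of this action in the various K-bases of K^n, so A is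
    triangularizable exactly when K^n has a chain of R-submodules whose
    successive quotients have dimension at most 1 over K
    ([triangularizable_flagged]). Such chains are handled upstairs: a submodule
    N of a left R-module U is called [flagged] when U can be reached from N by
    adjoining, one at a time, vectors w that are eigenvectors modulo what is
    already there, (t - a) w being in it. Steps with w already present are
    permitted, so quotients and intersections need no bookkeeping of dimensions.

    For U = R and N = R f, being flagged means that f is a product of linear
    factors up to a unit on the left ([flagged_linear_product],
    [flagged_left_ideal], [ore_monicP]): a step of the chain from R f to R
    splits one factor off f.

    The preimage of a flagged submodule under an R-linear map is flagged
    ([flagged_preim]), because a chain with one-dimensional steps can be
    intersected with any submodule. Write P (tI - A) Q = diag(d_1, ..., d_n),
    so that R^n / R^n (tI - A) is the direct sum of the R / R d_i.

    If A is triangularizable, R^n (tI - A) is flagged in R^n, and R e_r is its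
    preimage under x |-> x (row of Q^-1 at the index of e_r), which embeds
    R / R e_r as a direct summand; hence e_r is a product of linear factors.

    Conversely, if e_r is such a product, R e_r is flagged. Each d_i is a left
    factor of e_r, say e_r = d_i y, or is a unit; since right multiplication by
    y embeds R / R d_i into R / R e_r, each R d_i is flagged. Flags of direct
    summands concatenate ([flagged_diag]), and pulling back along Q shows that
    R^n (tI - A) is flagged. A triangularizing basis of K^n is then extracted
    from the chain by discarding the redundant vectors; that it has n elements
    is the invariance of dimension over a division ring. *)

(** * Scalars and division by t - a in the Ore ring *)

Section OreConst.
Variables (K : nzRingType) (S : {rmorphism K -> K}) (D : sderivation S).

Fact ore_const_zmod_morphism : zmod_morphism (ore_const D).
Proof. by move=> a b; rewrite /ore_const polyCB. Qed.
HB.instance Definition _ := GRing.isZmodMorphism.Build K (ore D) (ore_const D)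
  ore_const_zmod_morphism.

Fact ore_const_monoid_morphism : monoid_morphism (ore_const D).
Proof.
by split=> // a b; rewrite ore_constE /ore_const -mul_polyC polyCM.
Qed.
HB.instance Definition _ := GRing.isMonoidMorphism.Build K (ore D) (ore_const D)
  ore_const_monoid_morphism.

Lemma coef_oreB (f g : ore D) i :
  ((f - g : ore D) : {poly K})`_i = (f : {poly K})`_i - (g : {poly K})`_i.
Proof. exact: coefB. Qed.

Lemma coef_ore_mult (f : ore D) i :
  (f * ore_t D : {poly K})`_i = if i is j.+1 then (f : {poly K})`_j else 0.
Proof.
rewrite -[f * _]/(ore_mul _ _ _) /ore_mul /ore_t.
have E j : iter j (tmul D) 'X = 'X^(j.+1).
  by elim: j => //= j ->; rewrite tmulXn.
under eq_bigr do rewrite E.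
transitivity (((f : {poly K}) * 'X)`_i); last by rewrite coefMX; case: i.
congr (polyseq _)`_i; rewrite -[in RHS](coefK (f : {poly K})) poly_def mulr_suml.
by apply: eq_bigr => j _; rewrite -scalerAl exprSr.
Qed.

Lemma size_iter_tmul_leq i (q : {poly K}) :
  (size (iter i (tmul D) q) <= size q + i)%N.
Proof.
elim: i => [|i IH]; first by rewrite addn0.
rewrite iterS addnS /tmul (leq_trans (size_polyD _ _)) // geq_max.
rewrite (leq_trans (size_polyMleq _ _)) ?size_polyX ?addn2 ?ltnS /=; last first.
  by rewrite (leq_trans (size_poly _ _)).
by rewrite (leq_trans (size_poly _ _)) // ltnW.
Qed.

Lemma size_ore_mul_const (f : ore D) a :
  (size (f * ore_const D a : {poly K})%R <= size (f : {poly K}))%N.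
Proof.
rewrite -[f * _]/(ore_mul _ _ _) /ore_mul.
apply: (leq_trans (size_sum _ _ _)); apply/bigmax_leqP => i _.
apply: (leq_trans (size_scale_leq _ _)).
apply: (leq_trans (size_iter_tmul_leq _ _)).
by rewrite (leq_trans _ (ltn_ord i)) // -add1n leq_add2r size_polyC_leq1.
Qed.

(** Right division by t - a leaves a scalar remainder, that is
    R = R (t - a) + K. It suffices to divide the powers of t, where
    t e = S(e) (t - a) + (S(e) a + D(e)). *)
Lemma ore_div_linear (a : K) (r : ore D) :
  exists (q : ore D) (e : K), r = q * (ore_t D - ore_const D a) + ore_const D e.
Proof.
rewrite (ore_expansion r); elim: (size _) => [|m [q [e IH]]].
  by exists 0, 0; rewrite big_ord0 mul0r raddf0 addr0.
rewrite big_ord_recr /= IH.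
have [q' [e' ->]] : exists (q : ore D) (e : K),
    ore_t D ^+ m = q * (ore_t D - ore_const D a) + ore_const D e.
  elim: m {q e IH} => [|m [q [e IH]]].
    by exists 0, 1; rewrite mul0r add0r rmorph1.
  exists (ore_t D * q + ore_const D (S e)), (S e * a + D e).
  rewrite exprS IH mulrDr mulrA ore_commutation rmorphD rmorphM /= mulrDl.
  by rewrite -!addrA; congr (_ + _); rewrite addrA mulrBr subrK.
exists (q + ore_const D (r : {poly K})`_m * q').
exists (e + (r : {poly K})`_m * e').
by rewrite rmorphD rmorphM /= (mulrDr (ore_const D _)) (mulrDl q) mulrA addrACA.
Qed.

End OreConst.

(** * Degrees over a division ring *)

Section Division.
Variables (K : unitRingType) (divK : forall x : K, x != 0 -> x \is a GRing.unit).
Variables (S : {rmorphism K -> K}) (injS : injective S) (D : sderivation S).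
Implicit Types (f g : ore D).

Lemma division_mulf_neq0 (x y : K) : x != 0 -> y != 0 -> x * y != 0.
Proof.
move=> /divK x0; apply: contra_neq => xy0.
by rewrite -(mulKr x0 y) xy0 mulr0.
Qed.

Lemma scale_size (a : K) (q : {poly K}) : a != 0 -> q != 0 ->
  size (a *: q) = size q /\ lead_coef (a *: q) = a * lead_coef q.
Proof.
move=> a0 q0; have n0 : lead_coef a%:P * lead_coef q != 0.
  by rewrite lead_coefC division_mulf_neq0 ?lead_coef_eq0.
rewrite -mul_polyC size_proper_mul // lead_coef_proper_mul // lead_coefC.
by rewrite size_polyC a0.
Qed.

(** The D-part of t q has degree at most deg q, while injectivity of S keeps
    the leading coefficient S(lc q) of the other part from vanishing. *)
Lemma tmul_size (q : {poly K}) :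
  q != 0 -> size (tmul D q) = (size q).+1 /\ lead_coef (tmul D q) = S (lead_coef q).
Proof.
move=> q0; have sS : size (map_poly S q) = size q.
  by rewrite size_map_inj_poly ?rmorph0.
have sSX : size (map_poly S q * 'X) = (size q).+1.
  by rewrite size_mulX -?size_poly_eq0 sS ?size_poly_eq0.
have lt : (size (map_poly D q) < size (map_poly S q * 'X)%R)%N.
  by rewrite sSX ltnS size_poly.
rewrite /tmul size_polyDl // lead_coefDl // sSX; split=> //.
by rewrite lead_coefMX lead_coef_map_inj ?rmorph0.
Qed.

Lemma iter_tmul_size i (q : {poly K}) : q != 0 ->
  size (iter i (tmul D) q) = (size q + i)%N /\
  lead_coef (iter i (tmul D) q) = iter i S (lead_coef q).
Proof.
move=> q0; elim: i => [|i [IHs IHl]]; first by rewrite addn0.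
have /tmul_size [ss ll] : iter i (tmul D) q != 0.
  by rewrite -size_poly_gt0 IHs addn_gt0 size_poly_gt0 q0.
by rewrite !iterS ss ll IHs IHl addnS.
Qed.

(** Only the leading term of f contributes to the top degree of f g, with
    coefficient lc(f) S^(deg f)(lc g). *)
Lemma ore_mul_size f g : f != 0 -> g != 0 ->
  size (f * g : {poly K}) = (size (f : {poly K}) + size (g : {poly K})).-1 /\
  lead_coef (f * g : {poly K}) =
    lead_coef (f : {poly K}) * iter (size (f : {poly K})).-1 S (lead_coef (g : {poly K})).
Proof.
move=> f0 g0; rewrite -[f * g]/(ore_mul _ _ _) (ore_mulE D g (leqnn _)).
have : (0 < size (f : {poly K}))%N by rewrite size_poly_gt0.
rewrite [lead_coef f]/lead_coef.
have : (f : {poly K})`_(size (f : {poly K})).-1 != 0 by rewrite -/(lead_coef f) lead_coef_eq0.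
move: (size (f : {poly K})) => [//|m] /= lf _.
rewrite big_ord_recr /=; have [ss ll] := iter_tmul_size m g0.
have ig0 : iter m (tmul D) g != 0.
  by rewrite -size_poly_gt0 ss addn_gt0 size_poly_gt0 g0.
have [sZ lZ] := scale_size lf ig0; rewrite ss in sZ; rewrite ll in lZ.
set p := \sum_(i < m) _.
have sp : (size p < size (f`_m *: iter m (tmul D) g))%N.
  rewrite sZ; apply: (@leq_ltn_trans (size (g : {poly K}) + m).-1).
    apply: (leq_trans (size_sum _ _ _)); apply/bigmax_leqP => i _.
    apply: (leq_trans (size_scale_leq _ _)).
    rewrite (iter_tmul_size i g0).1 -ltnS prednK ?ltn_add2l //.
    by rewrite addn_gt0 size_poly_gt0 g0.
  by rewrite prednK // addn_gt0 size_poly_gt0 g0.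
rewrite (addrC p) (addnC m) -lZ -sZ; split; first exact: size_polyDl.
exact: lead_coefDl.
Qed.

Lemma ore_mulf_neq0 f g : f != 0 -> g != 0 -> f * g != 0.
Proof.
move=> f0 g0; rewrite -[f * g == 0]size_poly_eq0 (ore_mul_size f0 g0).1.
move: f0 g0; rewrite -[f == 0]size_poly_eq0 -[g == 0]size_poly_eq0.
by case: (size _) => [|m] // _; case: (size _) => // k _; rewrite addnS.
Qed.

Lemma ore_mulIr g x y : g != 0 -> x * g = y * g -> x = y.
Proof.
move=> g0 /eqP; rewrite -subr_eq0 -mulrBl => /eqP h.
apply/eqP; rewrite -subr_eq0; apply: contraT => /ore_mulf_neq0 /(_ g0).
by rewrite h eqxx.
Qed.

End Division.

(** * Flagged submodules *)

Section Flags.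
Variables (K : unitRingType) (S : {rmorphism K -> K}) (D : sderivation S).
Local Notation R := (ore D).

Definition submodule (U : lmodType R) (N : U -> Prop) : Prop :=
  N 0 /\ forall (r : R) u v, N u -> N v -> N (r *: u + v).

Definition adjoin (U : lmodType R) (N : U -> Prop) (w u : U) : Prop :=
  exists c : K, N (u - ore_const D c *: w).

(** U / N has a finite chain of R-submodules, each obtained from the previous
    one by adjoining a single vector over K. The condition on (t - a) w is what
    makes the K-span of N and w an R-submodule. *)
Inductive flagged (U : lmodType R) (N : U -> Prop) : Prop :=
| FlagTop of (forall u, N u)
| FlagStep a w of N ((ore_t D - ore_const D a) *: w) & flagged (adjoin N w).

Section Submodule.
Variables (U : lmodType R) (N : U -> Prop) (subN : submodule N).

Lemma submodule0 : N 0. Proof. exact: subN.1. Qed.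

Lemma submoduleZ (r : R) u : N u -> N (r *: u).
Proof. by move=> Nu; rewrite -[r *: u]addr0; apply: subN.2 => //; apply: submodule0. Qed.

Lemma submoduleD u v : N u -> N v -> N (u + v).
Proof. by move=> Nu Nv; rewrite -[u]scale1r; apply: subN.2. Qed.

Lemma submoduleB u v : N u -> N v -> N (u - v).
Proof. by move=> Nu Nv; rewrite addrC -scaleN1r; apply: subN.2. Qed.

Lemma submodule_subr u v : N (u - v) -> N v -> N u.
Proof. by move=> Nuv Nv; rewrite -[u](subrK v); apply: submoduleD. Qed.

(** Because R = R (t - a) + K, R w is contained in N + K w. *)
Lemma submodule_adjoin a w :
  N ((ore_t D - ore_const D a) *: w) -> submodule (adjoin N w).
Proof.
move=> Naw; split=> [|r u v [c Nu] [d Nv]].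
  by exists 0; rewrite raddf0 scale0r subr0; apply: submodule0.
have [q [e rE]] := ore_div_linear a (r * ore_const D c).
exists (e + d); rewrite raddfD scalerDl.
have -> : r *: u + v - (ore_const D e *: w + ore_const D d *: w) =
    (r *: (u - ore_const D c *: w) + (v - ore_const D d *: w))
    + q *: ((ore_t D - ore_const D a) *: w).
  rewrite scalerBr !scalerA rE scalerDl (opprD (_ *: w)) addrACA.
  rewrite [RHS]addrAC; congr (_ + _).
  by rewrite opprD -addrA [in RHS]addrAC addNr add0r.
by apply: submoduleD; [apply: subN.2 | apply: submoduleZ].
Qed.

End Submodule.

(** The R-linear map R -> U sending 1 to v; multiplication by v on the right
    when U is R itself. *)
Definition scale_at (U : lmodType R) (v : U) (r : R^o) : U := r *: v.

Fact scale_at_linear (U : lmodType R) (v : U) : linear (scale_at v).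
Proof. by move=> r x y; rewrite /scale_at scalerDl scalerA. Qed.
HB.instance Definition _ (U : lmodType R) (v : U) :=
  GRing.isLinear.Build R R^o U _ (scale_at v) (scale_at_linear v).

Lemma eq_flagged (U : lmodType R) (N N' : U -> Prop) :
  (forall u, N u <-> N' u) -> flagged N -> flagged N'.
Proof.
by move=> NN'; have -> : N = N' by apply/funext=> u; apply/propext.
Qed.

(** The preimage of N + K w is either the preimage of N, or that preimage with
    one vector u adjoined, where phi u = w modulo N; in the second case u is an
    eigenvector modulo the preimage with the same eigenvalue as w. *)
Lemma flagged_preim (divK : forall x : K, x != 0 -> x \is a GRing.unit)
    (U V : lmodType R) (phi : {linear U -> V}) (N : V -> Prop) :
  flagged N -> submodule N -> flagged (fun u => N (phi u)).
Proof.
elim=> {N} [N full|N a w Naw _ IH] subN; first by apply: FlagTop.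
have := IH (submodule_adjoin subN Naw).
have [[u Nu]|nNu] := pselect (exists u, N (phi u - w)) => fN.
  apply: (@FlagStep _ _ a u).
    rewrite linearZ /=; apply: (submodule_subr subN _ Naw).
    by rewrite -scalerBr; apply: submoduleZ.
  apply: eq_flagged fN => x; split=> -[c Nx]; exists c.
    rewrite linearB linearZ /=; apply: (submodule_subr subN
      (v := - (ore_const D c *: (phi u - w)))).
      by rewrite opprK scalerBr addrA subrK.
    by rewrite -scaleNr; apply: submoduleZ.
  rewrite linearB linearZ /= in Nx.
  apply: (submodule_subr subN (v := ore_const D c *: (phi u - w))).
    by rewrite scalerBr opprB addrA subrK.
  exact: submoduleZ.
apply: eq_flagged fN => x; split=> [[c Nx]|Nx]; last first.
  by exists 0; rewrite raddf0 scale0r subr0.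
have [c0|c0] := eqVneq c 0; first by move: Nx; rewrite c0 raddf0 scale0r subr0.
(* A nonzero multiple of w is hit modulo N, hence w itself is. *)
case: nNu; exists (ore_const D c^-1 *: x).
have := submoduleZ subN (ore_const D c^-1) Nx.
by rewrite scalerBr scalerA -rmorphM mulVr ?divK // rmorph1 scale1r linearZ.
Qed.

(** Concatenation of flags: if N' = N + phi(U) and phi induces a map from U / I
    onto N' / N, then a flag from I to U is carried to one from N to N', which
    a flag from N' to V continues. *)
Lemma flagged_extend (U V : lmodType R) (phi : {linear U -> V}) (I : U -> Prop) :
  flagged I -> forall N N' : V -> Prop, submodule N ->
  (forall u, I u -> N (phi u)) ->
  (forall v, N' v <-> exists u, N (v - phi u)) ->
  flagged N' -> flagged N.
Proof.
elim=> {I} [I full|I a w Iaw _ IH] N N' subN IN N'E fN'.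
  apply: eq_flagged fN' => v; rewrite N'E; split=> [[u Nvu]|Nv].
    exact: (submodule_subr subN Nvu (IN _ (full _))).
  by exists 0; rewrite linear0 subr0.
have Nw : N ((ore_t D - ore_const D a) *: phi w).
  by have := IN _ Iaw; rewrite linearZ.
apply: (FlagStep Nw); apply: (IH _ N') => //.
- exact: submodule_adjoin Nw.
- by move=> u [c Iu]; exists c; have := IN _ Iu; rewrite linearB linearZ.
move=> v; rewrite N'E; split=> [[u Nu]|[u [c Nu]]].
  by exists u, 0; rewrite raddf0 scale0r subr0.
by exists (u + ore_const D c *: w); rewrite linearD linearZ /= opprD addrA.
Qed.

Definition left_ideal (f : R) (x : R^o) : Prop := exists y : R, x = y * f.

Lemma submodule_left_ideal f : submodule (left_ideal f).
Proof.
split=> [|r _ _ [x ->] [y ->]]; first by exists 0; rewrite mul0r.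
by exists (r * x + y); rewrite mulrDl -mulrA.
Qed.

Definition linear_product (s : seq K) : R :=
  \prod_(a <- s) (ore_t D - ore_const D a).

Lemma linear_product_cons a s :
  linear_product (a :: s) = (ore_t D - ore_const D a) * linear_product s.
Proof. exact: big_cons. Qed.

(** The chain R l_1 ... l_m, R l_2 ... l_m, ..., R: by division by l_1 = t - a,
    the second ideal is the first one plus K l_2 ... l_m. *)
Lemma flagged_linear_product s : flagged (left_ideal (linear_product s)).
Proof.
elim: s => [|a s IH].
  by apply: FlagTop => u; exists u; rewrite /linear_product big_nil mulr1.
rewrite linear_product_cons; set g := linear_product s in IH *.
apply: (@FlagStep R^o (left_ideal _) a g); first by exists 1; rewrite mul1r.
apply: eq_flagged IH => x; split=> [[y ->]|[c [y /eqP]]].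
  have [q [e ->]] := ore_div_linear a y; exists e, q.
  by rewrite mulrDl addrK mulrA.
rewrite subr_eq => /eqP ->; exists (y * (ore_t D - ore_const D a) + ore_const D c).
by rewrite (mulrDl (y * _)) mulrA.
Qed.

(** Say I + K w = R g with w outside I. Then g generates the same quotient line
    as w, so t g = b g modulo I for some scalar b. The ideal I contains
    R (t - b) g and equals it: the remainder of an element of R g modulo
    (t - b) g is a scalar multiple of g, and g is not in I. *)
Lemma flagged_left_ideal (divK : forall x : K, x != 0 -> x \is a GRing.unit)
    (I : R^o -> Prop) : flagged I -> submodule I ->
  exists s, forall x, I x <-> left_ideal (linear_product s) x.
Proof.
elim=> {I} [I full|I a w Iaw _ IH] subI.
  exists [::] => x; split=> // _.
  by exists x; rewrite /linear_product big_nil mulr1.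
have [s IwE] := IH (submodule_adjoin subI Iaw).
set g := linear_product s in IwE.
have subIw x : I x -> left_ideal g x.
  by move=> Ix; apply/IwE; exists 0; rewrite raddf0 scale0r subr0.
have [Iw|nIw] := pselect (I w).
  exists s => x; split=> [|/IwE[c Ix]]; first exact: subIw.
  by apply: (submodule_subr subI Ix); apply: submoduleZ.
have [y wE] : left_ideal g w.
  by apply/IwE; exists 1; rewrite rmorph1 scale1r subrr; apply: submodule0.
have nIg : ~ I g by move=> /(submoduleZ subI y) Ig; apply: nIw; rewrite wE.
have [c Ig] : adjoin I w g by apply/IwE; exists 1; rewrite mul1r.
have c0 : c != 0.
  by apply/eqP=> c0; move: Ig; rewrite c0 raddf0 scale0r subr0.
have [c1 Itg] : adjoin I w (ore_t D *: (g : R^o)) by apply/IwE; exists (ore_t D).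
have Ibg : I ((ore_t D - ore_const D (c1 * c^-1)) * g).
  have := submoduleB subI Itg (submoduleZ subI (ore_const D (c1 * c^-1)) Ig).
  by rewrite scalerBr scalerA -rmorphM mulrVK ?divK // opprB addrA subrK mulrBl.
exists (c1 * c^-1 :: s) => x; rewrite linear_product_cons -/g.
split=> [Ix|[z ->]]; last exact: submoduleZ.
have [z xE] := subIw _ Ix.
have [q [e zE]] := ore_div_linear (c1 * c^-1) z.
exists q; rewrite xE zE mulrDl mulrA.
have [->|e0] := eqVneq e 0; first by rewrite raddf0 mul0r addr0.
case: nIg; have Ieg : I (ore_const D e *: (g : R^o)).
  apply: (submodule_subr subI
    (v := - (q * ((ore_t D - ore_const D (c1 * c^-1)) * g)))).
    by move: Ix; rewrite xE zE mulrDl opprK mulrA addrC.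
  by rewrite -mulNr; apply: submoduleZ.
have := submoduleZ subI (ore_const D e^-1) Ieg.
by rewrite scalerA -rmorphM mulVr ?divK // rmorph1 scale1r.
Qed.

(** R^n / R^n diag(d) is the direct sum of the R / R d_i, whose flags are
    concatenated by imposing the conditions x_i in R d_i one index at a time. *)
Lemma flagged_diag n (d : 'rV[R]_n) :
  (forall i, flagged (left_ideal (d 0 i))) ->
  flagged (fun x : 'rV[R]_n => exists z : 'rV[R]_n, x = z *m diag_mx d).
Proof.
move=> fd; pose N (s : seq 'I_n) (x : 'rV[R]_n) :=
  forall i, i \in s -> left_ideal (d 0 i) (x 0 i).
apply: (@eq_flagged _ (N (enum 'I_n))) => [x|].
  split=> [Nx|[z ->] i _]; last by exists (z 0 i); rewrite mul_mx_diag mxE.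
  have /choice [z zE] i : exists y, x 0 i = y * d 0 i by apply: Nx; rewrite mem_enum.
  by exists (\row_i z i); apply/rowP=> i; rewrite mul_mx_diag !mxE.
elim: (enum _) (enum_uniq 'I_n) => [_|i s IH /= /andP[nis us]]; first by apply: FlagTop.
pose phi := scale_at (delta_mx 0 i : 'rV[R]_n).
have phiE r j : phi r 0 j = if j == i then r else 0.
  by rewrite mxE mxE eqxx /=; case: eqP => _; rewrite ?mulr1 ?mulr0.
apply: (flagged_extend (phi := phi) (fd i) _ _ _ (IH us)).
- split=> [j _|r x y Nx Ny j sj]; first by rewrite mxE; apply: submodule0 (submodule_left_ideal _).
  by rewrite !mxE; apply: (submodule_left_ideal _).2; [apply: Nx | apply: Ny].
- move=> r Ir j _; rewrite phiE; case: eqP => [-> //|_].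
  exact: submodule0 (submodule_left_ideal _).
move=> x; split=> [Nx|[r Nx] j sj].
  exists (x 0 i) => j; rewrite mxE [X in _ + X]mxE phiE inE; case: eqP => /= [->|_ sj].
    by rewrite subrr => _; apply: submodule0 (submodule_left_ideal _).
  by rewrite subr0; apply: Nx.
have := Nx j; rewrite mxE [X in _ + X]mxE phiE inE sj orbT.
have /negPf -> : j != i by apply: contraNneq nis => <-.
by rewrite subr0; apply.
Qed.

End Flags.

(** * Invariance of dimension over a division ring *)

Section DivisionMatrices.
Variables (K : unitRingType) (divK : forall x : K, x != 0 -> x \is a GRing.unit).

(** More unknowns than equations: Gaussian elimination on the first column. *)
Lemma division_left_kernel m n (A : 'M[K]_(m, n)) :
  (n < m)%N -> exists2 v : 'rV[K]_m, v != 0 & v *m A = 0.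
Proof.
elim: n m A => [|n IH] [//|m] A.
  move=> _; exists (const_mx 1); last by apply/rowP; case.
  by apply/eqP=> /rowP/(_ 0)/eqP; rewrite !mxE oner_eq0.
rewrite ltnS -[n.+1]/(1 + n)%N in A * => lt_nm.
have [/forallP A0|] := boolP [forall i, A i 0 == 0].
  have [v v0 vA] := IH _ (rsubmx A) (leqW lt_nm).
  exists v => //; rewrite -[A]hsubmxK mul_mx_row vA.
  suff -> : lsubmx A = 0 by rewrite mulmx0 row_mx0.
  apply/matrixP=> i j; rewrite !mxE ord1.
  by rewrite (_ : lshift n 0 = 0) ?(eqP (A0 i)) //; apply/val_inj.
rewrite negb_forall => /existsP[i Ai0].
(* The rows of B A are those of A other than row i, reduced by row i so that
   their first entry vanishes. *)
pose B : 'M[K]_(m, m.+1) := \matrix_j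
  (delta_mx 0 (lift i j) - (A (lift i j) 0 / A i 0) *: delta_mx 0 i).
have [v v0 vA] := IH _ (rsubmx (B *m A)) lt_nm.
exists (v *m B).
  apply: contra v0 => /eqP/rowP vB; apply/eqP/rowP=> j; rewrite mxE.
  have := vB (lift i j); rewrite !mxE => <-.
  have Bjk k : B k (lift i j) = (k == j)%:R.
    rewrite !mxE eqxx /= [lift i j == i]eq_sym (negPf (neq_lift i j)) mulr0 subr0.
    by rewrite (inj_eq lift_inj) eq_sym.
  rewrite (bigD1 j) //= Bjk eqxx mulr1 big1 ?addr0 // => k kj.
  by rewrite Bjk (negPf kj) mulr0.
rewrite -mulmxA -[B *m A]hsubmxK mul_mx_row vA.
suff -> : lsubmx (B *m A) = 0 by rewrite mulmx0 row_mx0.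
apply/matrixP=> j z; rewrite ord1 [LHS]mxE (_ : lshift n 0 = 0); last exact/val_inj.
have -> : (B *m A) j 0 = (row j B *m A) 0 0 by rewrite -row_mul [RHS]mxE.
rewrite rowK mulmxBl -scalemxAl -!rowE !mxE mulrVK ?divK ?subrr ?mul1r //.
Qed.

Lemma division_inverse_dim m n (A : 'M[K]_(m, n)) (B : 'M[K]_(n, m)) :
  A *m B = 1%:M -> (m <= n)%N.
Proof.
move=> AB; rewrite leqNgt; apply/negP=> /(division_left_kernel A)[v v0 vA].
by case/eqP: v0; rewrite -[v]mulmx1 -AB mulmxA vA mul0mx.
Qed.

End DivisionMatrices.

(** * The module R^n / R^n (tI - A) *)

Lemma mul_mx11 (K : pzRingType) n (w : 'M[K]_1) (p : 'rV[K]_n) : w *m p = w 0 0 *: p.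
Proof. by rewrite {1}[w]mx11_scalar mul_scalar_mx. Qed.

Section CharacteristicModule.
Variables (K : unitRingType) (S : {rmorphism K -> K}) (D : sderivation S).
Variables (n : nat) (A : 'M[K]_n).
Local Notation R := (ore D).
Local Notation row_const := (map_mx (ore_const D)).

(** The rows of P acted upon by t. *)
Definition pseudo_linear k (P : 'M[K]_(k, n)) : 'M[K]_(k, n) :=
  map_mx S P *m A + map_mx D P.

Definition char_submodule (x : 'rV[R]_n) : Prop :=
  exists y : 'rV[R]_n, x = y *m ore_char_mx D A.

Lemma submodule_char : submodule char_submodule.
Proof.
split=> [|r _ _ [x ->] [y ->]]; first by exists 0; rewrite mul0mx.
by exists (r *: x + y); rewrite mulmxDl scalemxAl.
Qed.

(** In R^n / R^n (tI - A), t acts on the image of K^n by pseudo_linear. *)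
Lemma t_scale_const (v : 'rV[K]_n) :
  char_submodule (ore_t D *: row_const v - row_const (pseudo_linear v)).
Proof.
exists (row_const (map_mx S v)); rewrite /ore_char_mx mulmxBr -map_mxM.
rewrite /pseudo_linear map_mxD opprD addrA [LHS]addrAC; congr (_ - _).
apply/rowP=> j; rewrite -diag_const_mx mul_mx_diag !mxE.
by rewrite ore_commutation addrK.
Qed.

Lemma ore_scale_closed (U : lmodType R) (N : U -> Prop) :
  N 0 -> (forall u v, N u -> N v -> N (u + v)) ->
  (forall c u, N u -> N (ore_const D c *: u)) ->
  (forall u, N u -> N (ore_t D *: u)) ->
  forall r u, N u -> N (r *: u).
Proof.
move=> N0 ND NC Nt r u Nu; rewrite (ore_expansion r) scaler_suml.
apply: (big_ind N) => // i _; rewrite -scalerA; apply: NC.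
elim: (i : nat) => [|m IH]; first by rewrite scale1r.
by rewrite exprS -scalerA; apply: Nt.
Qed.

(** K^n surjects onto R^n / R^n (tI - A): its image contains the basis vectors
    and is stable under K and t, hence under R. *)
Lemma char_submodule_const (x : 'rV[R]_n) :
  exists v : 'rV[K]_n, char_submodule (x - row_const v).
Proof.
have subN := submodule_char.
pose N (x : 'rV[R]_n) := exists v : 'rV[K]_n, char_submodule (x - row_const v).
have N0 : N 0 by exists 0; rewrite map_mx0 subr0; apply: submodule0.
have ND u v : N u -> N v -> N (u + v).
  move=> [a Na] [b Nb]; exists (a + b); rewrite map_mxD opprD addrACA.
  exact: submoduleD.
rewrite [x]row_sum_delta -/(N _); apply: (big_ind N) => // i _.
apply: ore_scale_closed => // [c u [v Nu]|u [v Nu]|].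
- exists (c *: v); rewrite map_mxZ -scalerBr; exact: submoduleZ.
- exists (pseudo_linear v); apply: (submodule_subr subN (v := ore_t D *: (u - row_const v))); last exact: submoduleZ.
  by rewrite scalerBr opprB addrC addrA subrK; apply: t_scale_const.
exists (delta_mx 0 i); rewrite map_delta_mx subrr; exact: submodule0.
Qed.

(** K^n embeds into R^n / R^n (tI - A), by degrees: if some entry of y has
    degree m, the largest possible, then the corresponding entry of y (tI - A)
    has degree m + 1, as y A has degree at most m. *)
Lemma char_submodule_const_eq0 (v : 'rV[K]_n) :
  char_submodule (row_const v) -> v = 0.
Proof.
move=> [y vE].
have eqk j k : (y 0 j : {poly K})`_k = ((y *m row_const A) 0 j : {poly K})`_k.+1.
  have := congr1 (fun x : 'rV[R]_n => (x 0 j : {poly K})`_k.+1) vE.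
  rewrite /= /ore_char_mx mulmxBr mxE coefC /= => /esym/eqP.
  rewrite mxE [X in _ + X]mxE coef_oreB subr_eq0 -diag_const_mx mul_mx_diag 2!mxE.
  by rewrite coef_ore_mult => /eqP.
suff y0 : y = 0.
  apply/rowP=> j; move: vE; rewrite y0 mul0mx => /rowP/(_ j)/(congr1 (fun p : {poly K} => p`_0)).
  by rewrite !mxE /ore_const coefC coef0.
have [m] : exists m, forall j, (size (y 0%R j : {poly K}) <= m)%N.
  exists (\max_j size (y 0%R j : {poly K})) => j.
  exact: (leq_bigmax (F := fun j => size (y 0 j : {poly K}))).
elim: m => [|m IH] sy.
  by apply/rowP=> j; rewrite mxE; apply/eqP; rewrite -size_poly_leq0.
apply: IH => j; apply/leq_sizeP => k; rewrite leq_eqVlt => /predU1P[<-|lt_mk]; last first.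
  by rewrite nth_default // (leq_trans (sy j)).
rewrite eqk nth_default // mxE.
apply: (leq_trans (size_sum _ _ _)); apply/bigmax_leqP => i _.
by rewrite mxE (leq_trans (size_ore_mul_const _ _)).
Qed.

(** When the rows p_1, p_2, ... of P satisfy t p_i = b_i1 p_1 + ... + b_ii p_i
    modulo N, adjoining them successively to N is a flag. The congruence modulo
    N makes the statement stable under adjoining p_1 and removing it from P. *)
Lemma flagged_of_triangular k (B : 'M[K]_k) (P : 'M[K]_(k, n)) (N : 'rV[R]_n -> Prop) :
  is_trig_mx B -> submodule N -> (forall x, char_submodule x -> N x) ->
  (forall u : 'rV_k, N (row_const (u *m (pseudo_linear P - B *m P)))) ->
  (forall x, exists c : 'rV_k, N (x - row_const (c *m P))) ->
  flagged N.
Proof.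
move=> trigB; elim/trigsqmx_ind: B / trigB P N => [|{}k b c B _ IH] P N subN CN NP full.
  by apply: FlagTop => x; have [c] := full x; rewrite thinmx0 mul0mx map_mx0 subr0.
pose p := usubmx P; pose Q := dsubmx P; have PE : P = col_mx p Q by rewrite vsubmxK.
have TPE : pseudo_linear P = col_mx (pseudo_linear p) (pseudo_linear Q).
  by rewrite /pseudo_linear PE !map_col_mx mul_col_mx add_col_mx.
rewrite TPE PE mul_block_col opp_col_mx add_col_mx mul0mx addr0 in NP.
have Np : N ((ore_t D - ore_const D (b 0 0)) *: row_const p).
  have := NP (row_mx 1%:M 0); rewrite mul_row_col mul1mx mul0mx addr0.
  rewrite map_mxB => Np.
  apply: (submodule_subr subN _ Np); rewrite scalerBl.
  rewrite mul_mx11 map_mxZ opprB addrA subrK; exact/CN/t_scale_const.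
apply: (FlagStep Np); apply: (IH Q).
- exact: submodule_adjoin Np.
- by move=> x Cx; exists 0; rewrite raddf0 scale0r subr0; apply: CN.
- move=> u; exists ((u *m c) 0 0).
  have := NP (row_mx 0 u); rewrite mul_row_col mul0mx add0r.
  by rewrite opprD addrA addrAC mulmxBr mulmxA mul_mx11 map_mxB map_mxZ.
move=> x; have [e] := full x; rewrite -[e]hsubmxK PE mul_row_col => Ne.
exists (rsubmx e), (lsubmx e 0 0); rewrite -map_mxZ.
rewrite mul_mx11 map_mxD opprD addrA addrAC in Ne.
exact: Ne.
Qed.

(** Along the flag, P holds a K-basis of the part of K^n lying in the current
    submodule, on which t acts by the triangular matrix B. Every adjoined
    vector is congruent to a row of scalars v, which is either already in the
    span of P or becomes a new last row. *)
Lemma triangular_of_flagged (divK : forall x : K, x != 0 -> x \is a GRing.unit)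
    (N : 'rV[R]_n -> Prop) : flagged N ->
  forall k (P : 'M[K]_(k, n)) (B : 'M[K]_k),
  submodule N -> (forall x, char_submodule x -> N x) ->
  is_trig_mx B -> pseudo_linear P = B *m P ->
  (forall c : 'rV_k, c *m P = 0 -> c = 0) ->
  (forall v : 'rV_n, N (row_const v) <-> exists c : 'rV_k, v = c *m P) ->
  exists k (P : 'M[K]_(k, n)) (B : 'M[K]_k),
  [/\ is_trig_mx B, pseudo_linear P = B *m P,
      forall c : 'rV_k, c *m P = 0 -> c = 0 &
      forall v : 'rV_n, exists c : 'rV_k, v = c *m P].
Proof.
elim=> {N} [N full|N a w Naw _ IH] k P B subN CN trigB TP freeP NP.
  by exists k, P, B; split=> // v; apply/NP.
have [v /CN Nwv] := char_submodule_const w.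
have subNw := submodule_adjoin subN Naw.
have CNw x : char_submodule x -> adjoin N w x.
  by move=> Cx; exists 0; rewrite raddf0 scale0r subr0; apply: CN.
have Nwv_scale c (u : 'rV_n) : N (row_const u - ore_const D c *: w) <->
    exists e : 'rV_k, u - c *: v = e *m P.
  rewrite -NP map_mxB map_mxZ; split=> Nu.
    rewrite -[row_const u](subrK (ore_const D c *: w)) -addrA -scalerBr.
    by apply: submoduleD => //; apply: submoduleZ.
  rewrite -[row_const u](subrK (ore_const D c *: row_const v)) -addrA -scalerBr.
  by apply: submoduleD => //; apply: submoduleZ => //; rewrite -opprB -scaleN1r; apply: submoduleZ.
have [[e vE]|nNv] := pselect (exists e : 'rV_k, v = e *m P).
  apply: (IH k P B) => // u; split=> [[c /Nwv_scale[f /eqP]]|uE].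
    rewrite subr_eq vE => /eqP ->; exists (f + c *: e).
    by rewrite mulmxDl scalemxAl.
  exists 0; apply/Nwv_scale; case: uE => f ->; exists f.
  by rewrite scale0r subr0.
have [b TvE] : exists b : 'rV_k, pseudo_linear v - a *: v = b *m P.
  apply/NP; rewrite map_mxB map_mxZ.
  have Nav : N ((ore_t D - ore_const D a) *: row_const v).
    by rewrite -[row_const v](subKr w) scalerBr; apply: submoduleB => //; apply: submoduleZ.
  rewrite -[row_const (pseudo_linear v)](subKr (ore_t D *: row_const v)) addrAC -scalerBl.
  by apply: submoduleB => //; apply/CN/t_scale_const.
apply: (IH _ (col_mx P v) (block_mx B 0 b a%:M)) => //.
- by rewrite is_trig_block_mx // eqxx trigB scalar_mx_is_trig.
- rewrite mul_block_col mul0mx addr0 -TvE mul_scalar_mx subrK -TP.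
  by rewrite /pseudo_linear !map_col_mx mul_col_mx add_col_mx.
- move=> c; rewrite -[c]hsubmxK mul_row_col.
  rewrite mul_mx11; set x := rsubmx c 0 0 => cE.
  have [x0|x0] := eqVneq x 0.
    move: cE; rewrite x0 scale0r addr0 => /freeP ->.
    by rewrite [rsubmx c]mx11_scalar -/x x0 raddf0 row_mx0.
  case: nNv; exists (- x^-1 *: lsubmx c); rewrite -scalemxAl.
  move/eqP: cE; rewrite addr_eq0 => /eqP ->.
  by rewrite scaleNr scalerN opprK scalerA mulVr ?divK // scale1r.
move=> u; split=> [[c /Nwv_scale[e /eqP]]|[c ->]].
  rewrite subr_eq => /eqP ->; exists (row_mx e c%:M).
  by rewrite mul_row_col mul_scalar_mx.
exists (rsubmx c 0 0); apply/Nwv_scale; exists (lsubmx c).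
by rewrite -{1}[c]hsubmxK mul_row_col mul_mx11 addrK.
Qed.

End CharacteristicModule.

(** * Triangularizable matrices *)

Section Triangularization.
Variables (K : unitRingType) (divK : forall x : K, x != 0 -> x \is a GRing.unit).
Variables (S : {rmorphism K -> K}) (D : sderivation S) (n : nat) (A : 'M[K]_n).
Local Notation R := (ore D).
Local Notation row_const := (map_mx (ore_const D)).

Lemma SD_similarP (B : 'M[K]_n) :
  SD_similar D A B <-> exists P P' : 'M[K]_n,
    [/\ P *m P' = 1%:M, P' *m P = 1%:M & pseudo_linear D A P = B *m P].
Proof.
split=> [[P [P' [[PP' P'P] ->]]]|[P [P' [PP' P'P TP]]]]; exists P, P'.
  by split=> //; rewrite mulmxDl -!mulmxA [P' *m P]P'P !mulmx1.
by split=> //; rewrite -mulmxDl -[_ + _]/(pseudo_linear D A P) TP -mulmxA PP' mulmx1.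
Qed.

(** Reversing the order of the basis turns upper into lower triangular
    matrices. *)
Lemma similar_reverse (B : 'M[K]_n) :
  SD_similar D A B -> SD_similar D A (mxsub (@rev_ord n) (@rev_ord n) B).
Proof.
have rev2 m p (X : 'M[K]_(m, n)) (Y : 'M[K]_(n, p)) :
    colsub (@rev_ord n) X *m rowsub (@rev_ord n) Y = X *m Y.
  apply/matrixP=> i j; rewrite !mxE [RHS](reindex_inj rev_ord_inj) /=.
  by apply: eq_bigr => k _; rewrite !mxE.
move=> /SD_similarP[P [P' [PP' P'P TP]]]; apply/SD_similarP.
exists (rowsub (@rev_ord n) P), (colsub (@rev_ord n) P'); split.
- apply/matrixP=> i j; have := congr1 (fun M : 'M_n => M (rev_ord i) (rev_ord j)) PP'.
  rewrite !mxE (inj_eq rev_ord_inj) => <-.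
  by apply: eq_bigr => k _; rewrite !mxE.
- by rewrite rev2.
rewrite /pseudo_linear !map_mxsub mul_rowsub_mx.
have -> : mxsub (@rev_ord n) (@rev_ord n) B = colsub (@rev_ord n) (rowsub (@rev_ord n) B).
  by apply/matrixP=> i j; rewrite !mxE.
rewrite rev2 mul_rowsub_mx -TP.
by apply/matrixP=> i j; rewrite !mxE.
Qed.

Lemma triangularizable_lower :
  SD_triangularizable D A -> exists B, SD_similar D A B /\ is_trig_mx B.
Proof.
move=> [B [AB /orP[lowB|upB]]]; first by exists B.
exists (mxsub (@rev_ord n) (@rev_ord n) B); split; first exact: similar_reverse.
apply/is_trig_mxP=> i j lt_ij; rewrite mxE.
have := is_trig_mxP upB (rev_ord j) (rev_ord i); rewrite mxE; apply=> /=.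
by apply: ltn_sub2l; rewrite ?ltnS // (leq_ltn_trans lt_ij).
Qed.

(** A flag from R^n (tI - A) to R^n is the same as a flag of the module K^n,
    and P collects the vectors of a basis adapted to it. *)
Lemma triangularizable_flagged :
  SD_triangularizable D A <-> flagged (@char_submodule _ _ D _ A).
Proof.
split=> [/triangularizable_lower[B [/SD_similarP[P [P' [_ P'P TP]]] trigB]]|fA].
  apply: (flagged_of_triangular (A := A) (P := P) trigB) => //.
  - exact: submodule_char.
  - move=> u; rewrite TP subrr mulmx0 map_mx0; exact: submodule0 (submodule_char _ _).
  move=> x; have [v Nv] := char_submodule_const A x; exists (v *m P').
  by rewrite -mulmxA P'P mulmx1.
have TP0 : pseudo_linear D A (0 : 'M_(0, n)) = (0 : 'M_0) *m 0 by rewrite !flatmx0.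
have NP0 (v : 'rV_n) : char_submodule A (row_const v) <-> exists c : 'rV_0, v = c *m 0.
  split=> [/char_submodule_const_eq0 ->|[c ->]]; first by exists 0; rewrite mul0mx.
  by rewrite mulmx0 map_mx0; apply: submodule0 (submodule_char _ _).
have [||c _|] := triangular_of_flagged divK fA (submodule_char D A) _ _ TP0 _ NP0 => //.
- by rewrite mx0_is_trig.
- exact: thinmx0.
move=> k [P [B [trigB TP freeP fullP]]].
have /choice[c cE] i := fullP (row i 1%:M).
pose P' : 'M_(n, k) := \matrix_i c i.
have P'P : P' *m P = 1%:M by apply/row_matrixP=> i; rewrite row_mul rowK -cE.
have PP' : P *m P' = 1%:M.
  apply/eqP; rewrite -subr_eq0; apply/eqP/row_matrixP=> i; rewrite row0.
  apply: freeP; rewrite -row_mul mulmxBl mul1mx -mulmxA P'P mulmx1 subrr.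
  exact: row0.
have /anti_leq kn : (k <= n <= k)%N.
  by rewrite (division_inverse_dim divK PP') (division_inverse_dim divK P'P).
subst k; exists B; split; last by rewrite /triangular trigB.
by apply/SD_similarP; exists P, P'.
Qed.

(** * Invariant factors *)

Lemma filter_enum_last m (p : pred 'I_m) (T : Type) (f : 'I_m -> T) s x :
  rcons s x = [seq f i | i <- enum 'I_m & p i] ->
  exists2 i : 'I_m, x = f i & forall j : 'I_m, p j -> (j <= i)%N.
Proof.
case/lastP E : [seq i <- enum 'I_m | p i] => [|l i]; first by case: s.
rewrite map_rcons => /rcons_inj[_ ->]; exists i => // j pj.
have : pairwise (fun i j : 'I_m => (i <= j)%N) (rcons l i).
  rewrite -E; apply: subseq_pairwise (filter_subseq _ _) _.
  rewrite -(pairwise_map val leq) val_enum_ord -sorted_pairwise; last exact: leq_trans.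
  exact: iota_sorted.
rewrite pairwise_rcons => /andP[/allP li _].
have : j \in rcons l i by rewrite -E mem_filter pj mem_enum.
by rewrite mem_rcons inE => /predU1P[->|/li].
Qed.

Lemma strong_chain_divides (d : 'rV[R]_n) :
  (forall i j : 'I_n, j = i.+1 :> nat -> strongly_divides (d 0 i) (d 0 j)) ->
  forall i j : 'I_n, (i <= j)%N -> exists y, d 0 j = d 0 i * y.
Proof.
move=> dd i j; move/subnKC; move: (j - i)%N => k; elim: k j => [|k IH] j.
  by rewrite addn0 => /val_inj <-; exists 1; rewrite mulr1.
move=> jE; have lt_ikn : (i + k < n)%N by rewrite -addnS jE ltnW.
have [y yE] := IH (Ordinal lt_ikn) erefl.
have [|c [_ [z cE] [w wE]]] := dd (Ordinal lt_ikn) j; first by rewrite /= -addnS.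
by exists (y * z * w); rewrite wE cE yE !mulrA.
Qed.

End Triangularization.

Lemma linear_product_monic (K : unitRingType)
    (divK : forall x : K, x != 0 -> x \is a GRing.unit)
    (S : {rmorphism K -> K}) (injS : injective S) (D : sderivation S) (s : seq K) :
  lead_coef (linear_product D s : {poly K}) = 1.
Proof.
elim: s => [|a s IH]; first by rewrite /linear_product big_nil; apply: lead_coef1.
rewrite linear_product_cons.
have lin : lead_coef (ore_t D - ore_const D a : {poly K}) = 1 by apply: lead_coefXsubC.
have l0 : ore_t D - ore_const D a != 0 by rewrite -[_ == 0]lead_coef_eq0 lin oner_neq0.
have s0 : linear_product D s != 0 by rewrite -[_ == 0]lead_coef_eq0 IH oner_neq0.
rewrite (ore_mul_size divK injS l0 s0).2 lin IH mul1r.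
by elim: (_.-1) => //= m ->; rewrite rmorph1.
Qed.

(** Since the units of R are the nonzero scalars, a nonzero principal left
    ideal has a single monic generator. *)
Lemma ore_monicP (K : unitRingType)
    (divK : forall x : K, x != 0 -> x \is a GRing.unit)
    (S : {rmorphism K -> K}) (injS : injective S) (D : sderivation S)
    (f : ore D) (s : seq K) :
  ore_monic f = linear_product D s <->
  forall x, left_ideal f x <-> left_ideal (linear_product D s) x.
Proof.
set g := linear_product D s; have lg := linear_product_monic divK injS D s.
have g0 : g != 0 by rewrite -[_ == 0]lead_coef_eq0 lg oner_neq0.
rewrite /ore_monic; set c := lead_coef f; split=> [fE|fg].
  have c0 : c != 0.
    apply: contraNneq g0 => /eqP; rewrite lead_coef_eq0 -fE => /eqP f0.
    by rewrite [X in _ * X]f0 mulr0.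
  rewrite -fE => x; split=> -[y ->].
    exists (y * ore_const D c); rewrite -mulrA [X in _ = _ * X]mulrA.
    by rewrite -rmorphM mulrV ?divK // rmorph1 mul1r.
  by exists (y * ore_const D c^-1); rewrite -mulrA.
have [y fE] : left_ideal g f by apply/fg; exists 1; rewrite mul1r.
have [z gE] : left_ideal f g by apply/fg; exists 1; rewrite mul1r.
have zy : z * y = 1.
  by apply: (ore_mulIr divK injS g0); rewrite -mulrA -fE -gE mul1r.
have z0 : z != 0 by apply: contra_eq_neq zy => ->; rewrite mul0r eq_sym oner_neq0.
have y0 : y != 0 by apply: contra_eq_neq zy => ->; rewrite mulr0 eq_sym oner_neq0.
have [e yE] : exists e, y = ore_const D e.
  exists (y : {poly K})`_0; apply: size1_polyC.
  have := (ore_mul_size divK injS z0 y0).1; rewrite zy size_poly1.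
  move: z0 y0; rewrite -[z == 0]size_poly_eq0 -[y == 0]size_poly_eq0.
  by case: (size _) => [|k] //; case: (size _) => [|[|l]] //=; rewrite !addnS.
have e0 : e != 0 by apply: contra_neq y0; rewrite yE => ->; apply: raddf0.
have cE : c = e.
  rewrite /c fE (ore_mul_size divK injS y0 g0).2 lg yE lead_coefC size_polyC e0 /=.
  by rewrite mulr1.
by rewrite fE yE mulrA -rmorphM cE mulVr ?divK // rmorph1 mul1r.
Qed.

Theorem theorem5p13 (K : unitRingType)
    (divK : forall x : K, x != 0 -> x \is a GRing.unit)
    (S : {rmorphism K -> K}) (bijS : bijective S) (D : sderivation S)
    (n : nat) (A : 'M[K]_n) (er : ore D)
    (her : last_invariant_factor A er) :
  SD_triangularizable D A <-> product_of_monic_linear (ore_monic er).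
Proof.
have injS := bij_inj bijS.
case: her => es [P [Q [d [[P' [PP' P'P]] [Q' [QQ' Q'Q]] PAQ dd eE]]]].
have chQ : ore_char_mx D A *m Q = P' *m diag_mx d.
  by rewrite -PAQ !mulmxA [P' *m P]P'P mul1mx.
have chP : P *m ore_char_mx D A = diag_mx d *m Q'.
  by rewrite -PAQ -mulmxA [Q *m Q']QQ' mulmx1.
have [i0 erE maxi0] := filter_enum_last eE.
rewrite triangularizable_flagged //; split=> [fA|[s sE]].
  have fer : flagged (left_ideal er).
    apply: eq_flagged (flagged_preim divK (scale_at (row i0 Q')) fA (submodule_char _ _)) => x.
    rewrite erE /= /scale_at; split=> [[y xE]|[y ->]].
      have : (x *: row i0 Q') *m Q = (y *m P') *m diag_mx d.
        by rewrite xE -!mulmxA chQ.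
      rewrite -scalemxAl -row_mul [Q' *m Q]Q'Q row1 mul_mx_diag.
      move=> /rowP/(_ i0); rewrite !mxE !eqxx mulr1 => ->.
      by eexists.
    exists (y *: row i0 P); rewrite -scalemxAl -row_mul chP row_mul row_diag_mx.
    by rewrite -scalemxAl -rowE scalerA.
  have [s sE] := flagged_left_ideal divK fer (submodule_left_ideal er).
  by exists s; apply/ore_monicP.
have erI : forall x, left_ideal er x <-> left_ideal (linear_product D s) x by apply/ore_monicP.
(* ore_monic 0 = 0, which is not a monic product. *)
have er0 : er != 0.
  apply: contra_eq_neq (linear_product_monic divK injS D s) => er0.
  rewrite -[linear_product D s]sE /ore_monic [X in _ * X]er0 mulr0.
  by rewrite lead_coef0 eq_sym oner_neq0.
have fer : flagged (left_ideal er).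
  by apply: eq_flagged (flagged_linear_product D s) => x; rewrite erI.
have fd i : flagged (left_ideal (d 0 i)).
  have [[y [_ yd]]|ninv] := pselect (invertible (d 0 i)).
    by apply: FlagTop => x; exists (x * y); rewrite -mulrA yd mulr1.
  have /(strong_chain_divides dd)[y yE] : (i <= i0)%N by apply: maxi0; apply/asboolPn.
  apply: eq_flagged (flagged_preim divK (scale_at (y : (ore D)^o)) fer (submodule_left_ideal er)) => x /=.
  rewrite erE yE; split=> [[z]|[z ->]]; last by exists z; rewrite mulrA.
  have y0 : y != 0 by apply: contraNneq er0 => y0; rewrite erE yE y0 mulr0.
  by rewrite mulrA => /(ore_mulIr divK injS y0) ->; exists z.
have subN : submodule (fun x : 'rV[ore D]_n => exists z : 'rV[ore D]_n, x = z *m diag_mx d).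
  split=> [|r _ _ [x ->] [y ->]]; first by exists 0; rewrite mul0mx.
  by exists (r *: x + y); rewrite mulmxDl scalemxAl.
apply: eq_flagged (flagged_preim divK (mulmxr Q) (flagged_diag fd) subN) => x /=.
split=> [[z xE]|[y ->]]; last by exists (y *m P'); rewrite -!mulmxA chQ.
by exists (z *m P); rewrite -mulmxA chP mulmxA -xE -mulmxA [Q *m Q']QQ' mulmx1.
Qed.
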